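(* Let $\mathcal A=(Q,\{a,b\},\delta)$ be an automaton in which $a$ is of type $[1,2][3,4]\backslash 1,3$ (with $1,2,3,4$ distinct states) and $b$ is of type $[x,y]\backslash x$ (with $x,y$ distinct states, not necessarily different from $1,2,3,4$). Then $\mathcal A$ is $3$-compressible and proper if and only if all of the following conditions hold: (1) $x\in\{1,2,3,4\}$; (2) if $x=1$, then $3b=4$ and $Orb_b(3)\not\subseteq\{3,4\}$; (3) if $x=2$, then $y\in\{1,3\}$ and (a) if $y=1$, then $3b=4$ and $4b\ne 3$, and (b) if $y=3$, then $1b\in\{3,4\}$; (4) if $x=3$, then $1b=2$ and $Orb_b(1)\not\subseteq\{1,2\}$; (5) if $x=4$, then $y\in\{1,3\}$ and (a) if $y=1$, then $3b\in\{1,2\}$, and (b) if $y=3$, then $1b=2$ and $2b\ne 1$. Moreover, if $\mathcal A$ is proper and $3$-compressible, then at least one of the words $ab^2a$, $ab^3a$ $3$-compresses $\mathcal A$.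
   Context: A (semi)automaton is $\mathcal A=(Q,\Sigma,\delta)$ with $Q$ a finite set of states, $\Sigma=\{a,b\}$, and $\delta:Q\times\Sigma\to Q$ total. Words act on states from the right, letter by letter from left to right: $qw$ is the state reached from $q$ by reading $w$, and $Qw=\{qw:q\in Q\}$. A word $w$ $3$-compresses $\mathcal A$ if $|Q|-|Qw|\ge 3$; $\mathcal A$ is $3$-compressible if some word $3$-compresses it. A $3$-compressible automaton is proper if no word of length $3$ $3$-compresses it. The letter $a$ is of type $[1,2][3,4]\backslash 1,3$ if $1a=2a$, $3a=4a$, $1a\ne 3a$, no other two distinct states have the same image under $a$, and $Q\setminus Qa=\{1,3\}$. The letter $b$ is of type $[x,y]\backslash x$ if $xb=yb$, no other two distinct states have the same image under $b$, and $Q\setminus Qb=\{x\}$. $Orb_b(q)=\{qb^n:n\ge 0\}$. *)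

(* Defs.v *)
From mathcomp Require Import all_boot.

Set Implicit Arguments.
Unset Strict Implicit.
Unset Printing Implicit Defensive.

Inductive letter : Type := La | Lb.

Definition word := seq letter.

Record automaton : Type := Automaton {
  state : finType;
  delta : state -> letter -> state
}.

Section Automaton.

Variable A : automaton.
Implicit Types (p q : state A) (l : letter) (w : word).

(* q w : words act on the right, their first letter being read first. *)
Definition act q w : state A := foldl (@delta A) q w.

(* Q w *)
Definition img w : {set state A} := [set act q w | q : state A].

Definition compresses3 w : bool := 3 <= #|state A| - #|img w|.

Definition compressible3 : Prop := exists w, compresses3 w.

(* Only the condition on words of length 3: 3-compressibility itself is not
   included, so that the proper 3-compressible automata are those satisfying
   compressible3 /\ proper3. *)
Definition proper3 : Prop := forall w, size w = 3 -> ~~ compresses3 w.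

(* type [q1, q2][q3, q4] \ q1, q3 *)
Definition type_two_pairs l q1 q2 q3 q4 : Prop :=
  [/\ delta q1 l = delta q2 l,
      delta q3 l = delta q4 l,
      delta q1 l <> delta q3 l,
      forall p q, p <> q -> delta p l = delta q l ->
        [set p; q] = [set q1; q2] \/ [set p; q] = [set q3; q4]
    & ~: img [:: l] = [set q1; q3]].

(* type [x, y] \ x *)
Definition type_one_pair l x y : Prop :=
  [/\ delta x l = delta y l,
      forall p q, p <> q -> delta p l = delta q l ->
        [set p; q] = [set x; y]
    & ~: img [:: l] = [set x]].

(* The action of l need not be injective; orbit is then still the forward orbit
   of q, as OrbP shows. *)
Definition Orb l q : {set state A} := [set p in orbit (fun r => delta r l) q].

Lemma OrbP l q p :
  reflect (exists n, p = act q (nseq n l)) (p \in Orb l q).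
Proof.
have actE n r : act r (nseq n l) = iter n (fun s => delta s l) r.
  by elim: n r => [//|n IHn] r; rewrite iterSr -IHn.
rewrite inE -fconnect_orbit; apply: (iffP idP) => [qp | [n ->]].
  by exists (findex (fun r => delta r l) q p); rewrite actE iter_findex.
by rewrite actE fconnect_iter.
Qed.

End Automaton.

(* Main.v *)
Require Import Defs.
From mathcomp Require Import all_boot.

Set Implicit Arguments.
Unset Strict Implicit.
Unset Printing Implicit Defensive.

(** The proof follows, instead of the image [Q w], its complement [missing w].
Reading one more letter [l] adds to [missing [:: l]] the images of the states
all of whose [l]-companions (the states with the same image under [l]) are
missing ([missing_rcons]); these states are called trapped. So a state that
shares its image with another one shields it: as long as at most one state of
each pair merged by [a] is missing, and nothing outside of [q1, q2, q3, q4]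
is, [a] resets the missing set to [q1, q3].

If the automaton is proper then [aba] forces [x] into [q1, q2, q3, q4]
([proper_x]) and [aab] forces [x] or [y] to be one of [q1, q3]
([compresses_aab]). The two pairs [q1, q2] and [q3, q4] play symmetric roles,
so let [x] be in the first one. After [a] the missing set is [q1, q3]; the first
[b] reduces it to [x] and the image of a single state [z] of [q1, q3], because
the other one is [x] or [y]. From then on each [b] keeps [x] missing and moves
the second missing state along the [b]-orbit of [z] ([missing_abk]). A following
[a] makes progress exactly when this second state has left [q3, q4]
([compresses_abka]), and otherwise resets the missing set to [q1, q3]. Hence all
reachable missing sets have at most two elements until [z b^k] leaves [q3, q4]
([missing_small]).

Therefore the automaton is proper iff [z b] is in [q3, q4], and it is then
compressible iff the orbit of [z b] leaves [q3, q4]. As that set has two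
elements, an orbit with three consecutive points in it never leaves
([iter_pair]), so that [z b^2] or [z b^3] must be outside: this is the criterion
[proper_compressibleE], and it shows that [ab^2a] or [ab^3a] 3-compresses. The
conditions of the theorem are this criterion spelled out for each position of
[x], using that [b] is injective apart from [x, y]. *)

(** * Evolution of the set of missing states *)

Section Missing.

Variable A : automaton.
Implicit Types (p q r : state A) (l : letter) (w : word) (S : {set state A}).

Definition missing w : {set state A} := ~: img A w.

(** The largest union of fibers of [l] inside [S]. *)
Definition trapped l S : {set state A} :=
  [set p | [forall q, (delta q l == delta p l) ==> (q \in S)]].

Lemma compresses3E w : compresses3 A w = (2 < #|missing w|).
Proof. by rewrite /compresses3 -(cardsC (img A w)) addKn. Qed.

Lemma missing_nil : missing [::] = set0.
Proof.
by apply/setP=> p; rewrite !inE; apply/negbF/imsetP; exists p.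
Qed.

Lemma trappedS l S (S' : {set state A}) :
  S \subset S' -> trapped l S \subset trapped l S'.
Proof.
move=> SS'; apply/subsetP=> p; rewrite !inE => /forallP tr.
apply/forallP=> q; apply/implyP=> qp.
exact: subsetP SS' _ (implyP (tr q) qp).
Qed.

(** A state is missed by [w l] when all its preimages under [l] are missed by
[w]: either it has none, or it is the image of a trapped state. *)
Lemma missing_rcons w l :
  missing (rcons w l) =
    missing [:: l] :|: [set delta p l | p in trapped l (missing w)].
Proof.
apply/setP=> r; rewrite !inE; apply/idP/orP => [nr|].
  case: (boolP (r \in img A [:: l])) => [/imsetP[p _ rp]|]; last by left.
  right; apply/imsetP; exists p => //.
  rewrite inE; apply/forallP=> q; apply/implyP=> /eqP qp.
  rewrite inE; apply: contra nr => /imsetP[s _ def_q].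
  by apply/imsetP; exists s => //; rewrite /act foldl_rcons -/(act s w) -def_q qp.
move=> nr; apply/negP=> /imsetP[s _].
rewrite /act foldl_rcons -/(act s w) => def_r.
case: nr => [/imsetP[]|/imsetP[p]]; first by exists (act s w).
rewrite inE => /forallP/(_ (act s w)) + rp; rewrite -def_r rp eqxx.
by rewrite inE imset_f.
Qed.

Lemma missing_rcons0 w l :
  trapped l (missing w) = set0 -> missing (rcons w l) = missing [:: l].
Proof. by rewrite missing_rcons => ->; rewrite imset0 setU0. Qed.

Lemma card_missing_rcons w l :
  #|missing (rcons w l)| =
    #|missing [:: l]| + #|[set delta p l | p in trapped l (missing w)]|.
Proof.
rewrite missing_rcons cardsU (_ : _ :&: _ = set0) ?cards0 ?subn0 //.
apply/setP=> r; rewrite !inE; apply/negP=> /andP[/imsetP nr /imsetP[p _ rp]].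
by case: nr; exists p.
Qed.

End Missing.

(** Among three consecutive points of an orbit inside a set of two elements, two
coincide, so that the orbit cycles within that set. *)
Lemma iter_pair (T : finType) (f : T -> T) (P : {set T}) s n :
    #|P| <= 2 -> s \in P -> f s \in P -> f (f s) \in P ->
  iter n f s \in P.
Proof.
move=> P2 Ps Pfs Pffs; suff: iter n f s \in [set s; f s].
  by rewrite !inE => /orP[] /eqP->.
elim: n => [|n /set2P[]] /=; rewrite ?set21 // => ->; rewrite ?set22 //.
case: (eqVneq s (f s)) => [sE|sfs]; first by rewrite -!sE set21.
rewrite (_ : [set s; f s] = P) //; apply/eqP.
rewrite eqEcard cards2 sfs P2 andbT.
by apply/subsetP=> r /set2P[]->.
Qed.

Lemma uniq4E (T : eqType) (t1 t2 t3 t4 : T) :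
  uniq [:: t1; t2; t3; t4] =
    [&& t1 != t2, t1 != t3, t1 != t4, t2 != t3, t2 != t4 & t3 != t4].
Proof. by rewrite /= !inE !negb_or -!andbA andbT. Qed.

Lemma type_two_pairsC A l (q1 q2 q3 q4 : state A) :
  type_two_pairs l q1 q2 q3 q4 -> type_two_pairs l q3 q4 q1 q2.
Proof.
case=> a12 a34 a13 inj_a na; split; rewrite ?[[set q3; q1]]setUC //.
  by move=> a31; case: a13.
by move=> p q pq /(inj_a _ _ pq)[]; [right | left].
Qed.

Section TypedLetters.

Variables (A : automaton) (q1 q2 q3 q4 x y : state A).
Hypotheses (uniq_q : uniq [:: q1; q2; q3; q4]) (neq_xy : x <> y).
Hypotheses (type_a : type_two_pairs La q1 q2 q3 q4).
Hypotheses (type_b : type_one_pair Lb x y).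

Implicit Types (p q r c s : state A) (w : word) (S : {set state A}).

Let b r : state A := delta r Lb.

Let q13 : q1 != q3.
Proof. by have := uniq_q; rewrite uniq4E => /and3P[]. Qed.

(** * One step of each letter *)

Lemma missing_a : missing A [:: La] = [set q1; q3].
Proof. by case: type_a. Qed.

Lemma missing_b : missing A [:: Lb] = [set x].
Proof. by case: type_b. Qed.

Lemma b_neq_x p : b p != x.
Proof.
have: x \in missing A [:: Lb] by rewrite missing_b set11.
by rewrite inE; apply: contraNneq => <-; apply: imset_f.
Qed.

Lemma eq_b p q : (b p == b q) = (p == q) || ([set p; q] \subset [set x; y]).
Proof.
case: type_b => bxy inj_b _; apply/eqP/idP => [pq|].
  by case: eqVneq => //= /eqP/inj_b/(_ pq)->; apply: subxx.
case/orP=> [/eqP-> //|/subsetP sub].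
by case/set2P: (sub p (set21 _ _)) => ->;
   case/set2P: (sub q (set22 _ _)) => ->.
Qed.

Lemma b_inj_out p q : p \notin [set x; y] -> b p = b q -> p = q.
Proof.
move=> pN /eqP; rewrite eq_b => /orP[/eqP//|/subsetP/(_ p (set21 _ _))].
by rewrite (negPf pN).
Qed.

Lemma trapped_a p S :
  (p \in trapped La S) =
    [&& p \in S, (p \in [set q1; q2]) ==> ([set q1; q2] \subset S)
      & (p \in [set q3; q4]) ==> ([set q3; q4] \subset S)].
Proof.
case: type_a => a12 a34 _ inj_a _; rewrite inE.
apply/forallP/and3P => [tr | [Sp S12 S34] q].
  split; first by have:= tr p; rewrite eqxx.
    apply/implyP=> p12; apply/subsetP=> q q12; apply: (implyP (tr q)).
    by case/set2P: p12 => ->; case/set2P: q12 => ->; rewrite ?a12.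
  apply/implyP=> p34; apply/subsetP=> q q34; apply: (implyP (tr q)).
  by case/set2P: p34 => ->; case/set2P: q34 => ->; rewrite ?a34.
apply/implyP=> /eqP qp; case: (eqVneq q p) => [-> //|/eqP/inj_a/(_ qp)[] E].
  by apply: (subsetP (implyP S12 _)); rewrite -E ?set21 ?set22.
by apply: (subsetP (implyP S34 _)); rewrite -E ?set21 ?set22.
Qed.

Lemma trapped_b p S :
  (p \in trapped Lb S) =
    (p \in S) && ((p \in [set x; y]) ==> ([set x; y] \subset S)).
Proof.
rewrite inE; apply/forallP/andP => [tr | [Sp Sxy] q].
  split; first by have:= tr p; rewrite eqxx.
  apply/implyP=> pxy; apply/subsetP=> q qxy; apply: (implyP (tr q)).
  rewrite [_ == _]eq_b; apply/orP; right.
  by apply/subsetP=> r /set2P[] ->.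
rewrite [_ == _]eq_b; case: eqVneq => [-> //|_] /=.
apply/implyP=> /subsetP sub; apply: (subsetP (implyP Sxy _)).
  exact: sub (set22 _ _).
exact: sub (set21 _ _).
Qed.

(** A missing [x] alone is shielded by [y]. *)
Lemma missing_rcons_b1 w :
  missing A w \subset [set x] -> missing A (rcons w Lb) = [set x].
Proof.
move=> Sx; rewrite missing_rcons0 ?missing_b //; apply/setP=> p.
rewrite trapped_b in_set0; apply/negP=> /andP[/(subsetP Sx)/set1P->].
rewrite set21 /= => /subsetP/(_ y (set22 _ _))/(subsetP Sx)/set1P yx.
by case: neq_xy.
Qed.

(** When only one state [s] of the pair merged by [b] is missing, it is shielded
and [c] moves on alone; when both are, then [s = x] and [c = y] by the last
hypothesis, and they move on to the same state. *)
Lemma missing_rcons_b2 w s c :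
    missing A w = [set s; c] -> s \in [set x; y] -> c != x ->
    (c = y -> s = x) ->
  missing A (rcons w Lb) = [set x; b c].
Proof.
case: type_b => bxy _ _ mw sxy cx cys.
rewrite missing_rcons missing_b mw; congr (_ :|: _); apply/setP=> r.
rewrite inE; apply/imsetP/eqP=> [[p]|->].
  rewrite trapped_b.
  move=> /andP[/set2P[]-> // /implyP/(_ sxy)/subsetP sub ->].
  have /set2P[yE|yE] := sub y (set22 _ _);
    have /set2P[xE|xE] := sub x (set21 _ _).
  - by case: neq_xy; rewrite xE.
  - by rewrite xE eqxx in cx.
  - by rewrite -xE -yE.
  - by case: neq_xy; rewrite xE.
exists c => //; rewrite trapped_b set22; apply/implyP=> /set2P[cE|cE].
  by rewrite cE eqxx in cx.
by rewrite (cys cE) cE.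
Qed.

Lemma trapped_a0 s c :
  s \in [set q1; q2] -> c \in s |: [set q3; q4] -> trapped La [set s; c] = set0.
Proof.
have := uniq_q; rewrite uniq4E !inE.
move=> /and5P[q12 _ q14 q23 /andP[q24 q34]] s12 cs34.
have neqs := (negPf q12, negPf q13, negPf q14, negPf q23, negPf q24, negPf q34).
have seqn := (eq_sym q2 q1, eq_sym q3 q1, eq_sym q4 q1, eq_sym q3 q2,
              eq_sym q4 q2, eq_sym q4 q3).
apply/setP=> p; rewrite trapped_a !subUset !sub1set !inE.
by case/or3P: cs34 => /eqP->; case/orP: s12 => /eqP->;
  do 5![rewrite ?eqxx ?seqn ?neqs ?andbF //=; try case: eqVneq => [->|_]].
Qed.

Lemma trapped_aN0 s c :
    s \in [set q1; q2] -> c != s -> c \notin [set q3; q4] ->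
  c \in trapped La [set s; c].
Proof.
move=> s12 cs c34; rewrite trapped_a set22 (negPf c34) andbT /=.
apply/implyP=> c12; apply/subsetP=> r r12; move: s12 c12 r12 cs.
by do 3![case/set2P=> ->]; rewrite ?set21 ?set22 ?eqxx.
Qed.

(** * Words of length three forced by properness *)

(** After [ab] the state [x] is missing, and if [a] merges it with no other
state then [aba] misses [x a] besides [q1] and [q3]. *)
Lemma proper_x : proper3 A -> x \in [set q1; q2; q3; q4].
Proof.
move=> /(_ [:: La; Lb; La] erefl); apply: contraNT => xN.
rewrite compresses3E (@card_missing_rcons A [:: La; Lb] La) missing_a.
rewrite cards2 q13 -[ltnLHS]addn0 ltn_add2l card_gt0 imset_eq0.
apply/set0Pn; exists x; move: xN; rewrite trapped_a !inE !negb_or -!andbA.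
case/and4P=> /negPf-> /negPf-> /negPf-> /negPf-> /=; rewrite andbT.
have := @missing_rcons A [:: La] Lb; rewrite missing_b => /setP/(_ x).
by rewrite [in RHS]inE set11 inE.
Qed.

(** The second [a] only pads [ab] to length three. *)
Lemma compresses_aab :
  q1 \notin [set x; y] -> q3 \notin [set x; y] -> compresses3 A [:: La; La; Lb].
Proof.
move=> n1 n3; rewrite compresses3E (@card_missing_rcons A [:: La; La] Lb).
have maa : missing A [:: La; La] = [set q1; q3].
  rewrite (@missing_rcons0 A [:: La] La) missing_a //.
  by rewrite trapped_a0 ?set21 // !inE eqxx orbT.
rewrite maa missing_b cards1 add1n ltnS.
have -> : trapped Lb [set q1; q3] = [set q1; q3].
  apply/setP=> p; rewrite trapped_b andb_idr // => /set2P[] ->.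
    by rewrite (negPf n1).
  by rewrite (negPf n3).
rewrite card_in_imset ?cards2 ?q13 // => p q /set2P[] -> _.
  exact: b_inj_out.
exact: b_inj_out.
Qed.

(** * The wandering missing state *)

Hypothesis x12 : x \in [set q1; q2].

(** After [a], the missing states are [s], which the next [b] absorbs, and [z],
which starts to wander. The last hypothesis on [z] allows for the case where
[q1] and [q3] are [x] and [y]: then [z] has to be [y]. *)
Section Wandering.

Variables (s z : state A).
Hypotheses (def_sz : [set q1; q3] = [set s; z]) (sxy : s \in [set x; y]).
Hypotheses (zx : z != x) (zys : z = y -> s = x).

Let c n : state A := iter n b z.

Lemma missing_abk k : missing A (La :: nseq k.+1 Lb) = [set x; c k.+1].
Proof.
have rcons_b n : La :: nseq n.+1 Lb = rcons (La :: nseq n Lb) Lb.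
  by rewrite rcons_cons; congr (_ :: _); elim: n => //= n ->.
elim: k => [|k IHk]; rewrite rcons_b.
  by apply: (missing_rcons_b2 (s := s)); rewrite // missing_a.
apply: (missing_rcons_b2 (s := x) (c := c k.+1)); rewrite ?set21 //.
exact: b_neq_x.
Qed.

(** The missing [x] lies in [q1, q2]: an [a] traps something unless the
wandering state is in the other pair. *)
Lemma compresses_abka k :
  compresses3 A (La :: rcons (nseq k.+1 Lb) La) = (c k.+1 \notin [set q3; q4]).
Proof.
rewrite compresses3E -rcons_cons card_missing_rcons missing_abk missing_a.
rewrite cards2 q13 -[ltnLHS]addn0 ltn_add2l card_gt0 imset_eq0.
congr (~~ _); apply/eqP/idP=> [tr0|c34].
  apply: contraT => /(trapped_aN0 x12 (b_neq_x (c k))).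
  by rewrite tr0 in_set0.
by rewrite trapped_a0 // inE c34 orbT.
Qed.

(** The listed sets are stable under both letters as long as the wandering state
stays in [q3, q4]. In a word [w] it is moved by at most [size w - 1] letters [b],
since an [a] comes first, and its position matters only if another [a] follows:
hence the bound on [k]. *)
Lemma missing_small w :
    (forall k, 0 < k -> k.+1 < size w -> c k \in [set q3; q4]) ->
  [\/ missing A w \subset [set x], missing A w = [set q1; q3]
    | exists2 k, 0 < k < size w & missing A w = [set x; c k]].
Proof.
elim/last_ind: w => [|w l IHw] cw.
  by constructor 1; rewrite missing_nil sub0set.
rewrite size_rcons in cw *; case: l.
  constructor 2; rewrite missing_rcons0 ?missing_a //.
  case: IHw => [k k0 kw|mw|mw|[k /andP[k0 kw] ->]].
  - exact: cw (ltnW kw).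
  - apply/eqP; rewrite -subset0 -(@trapped_a0 x x) ?setU11 //.
    by rewrite trappedS // setUid.
  - by rewrite mw trapped_a0 ?set21 // !inE eqxx orbT.
  - by rewrite trapped_a0 // inE cw ?orbT.
case: IHw => [k k0 kw|mw|mw|[k /andP[k0 kw] mw]].
- exact: cw (ltnW kw).
- by constructor 1; rewrite missing_rcons_b1.
- constructor 3; exists 1.
    case: w mw {cw} => //; rewrite missing_nil => /setP/(_ q1).
    by rewrite set21 in_set0.
  by apply: (missing_rcons_b2 (s := s)); rewrite // mw.
- constructor 3; exists k.+1; first by rewrite ltnS.
  apply: (missing_rcons_b2 (s := x)); rewrite ?set21 //.
  by case: k k0 {kw mw} => // k _; apply: b_neq_x.
Qed.

Lemma not_compresses3_small w :
    (forall k, 0 < k -> k.+1 < size w -> c k \in [set q3; q4]) ->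
  ~~ compresses3 A w.
Proof.
rewrite compresses3E -leqNgt.
case/missing_small=> [/subset_leq_card|->|[k _ ->]].
- by rewrite cards1 => /leq_trans->.
- by rewrite cards2; case: (_ != _).
- by rewrite cards2; case: (_ != _).
Qed.

Lemma proper3P : proper3 A <-> b z \in [set q3; q4].
Proof.
split=> [/(_ [:: La; Lb; La] erefl)|bz w w3].
  by rewrite (compresses_abka 0) negbK.
by apply: not_compresses3_small => -[|[|k]] //; rewrite w3.
Qed.

Lemma compressible_leaves :
    compressible3 A -> b z \in [set q3; q4] ->
  ~~ ((b (b z) \in [set q3; q4]) && (b (b (b z)) \in [set q3; q4])).
Proof.
move=> [w cw] c1; apply: contraL cw => /andP[c2 c3].
apply: not_compresses3_small => -[//|k] _ _.
rewrite /c iterSr; apply: iter_pair => //.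
by rewrite cards2; case: (_ != _).
Qed.

Lemma proper_compressibleE :
  (compressible3 A /\ proper3 A <->
    b z \in [set q3; q4] /\
    ~~ ((b (b z) \in [set q3; q4]) && (b (b (b z)) \in [set q3; q4])))
  /\ (proper3 A -> compressible3 A ->
    compresses3 A [:: La; Lb; Lb; La] \/ compresses3 A [:: La; Lb; Lb; Lb; La]).
Proof.
have short :
    ~~ ((b (b z) \in [set q3; q4]) && (b (b (b z)) \in [set q3; q4])) ->
    compresses3 A [:: La; Lb; Lb; La] \/ compresses3 A [:: La; Lb; Lb; Lb; La].
  by rewrite negb_and -(compresses_abka 1) -(compresses_abka 2) => /orP.
split; last first.
  by move=> /proper3P bz cA; apply/short/compressible_leaves.
split=> [[cA /proper3P bz] | [bz out]].
  by split=> //; apply: compressible_leaves.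
split; last exact/proper3P.
by case: (short out) => cw; eexists; apply: cw.
Qed.

End Wandering.

(** * The criterion for each position of x *)

Lemma iter_Orb n q : iter n b q \in Orb Lb q.
Proof. by rewrite inE -fconnect_orbit fconnect_iter. Qed.

(** Here [q1 = x] is absorbed and [q3] wanders; if [q3 b = q3] it never leaves,
which leaves only [q3 b = q4]. *)
Lemma proper_compressible_x1 :
    x = q1 ->
  (compressible3 A /\ proper3 A <->
     b q3 = q4 /\ ~~ (Orb Lb q3 \subset [set q3; q4]))
  /\ (proper3 A -> compressible3 A ->
    compresses3 A [:: La; Lb; Lb; La] \/ compresses3 A [:: La; Lb; Lb; Lb; La]).
Proof.
move=> xq1; have q3x : q3 != x by rewrite xq1 eq_sym.
have [| |iffE imp] := @proper_compressibleE q1 q3 erefl _ q3x.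
- by rewrite xq1 set21.
- by rewrite xq1.
split=> //; apply: iff_trans iffE _; split=> [[bq3 out]|[bq3 out]].
  split; last first.
    apply: contra out => /subsetP sub.
    by rewrite (sub _ (iter_Orb 2 q3)) (sub _ (iter_Orb 3 q3)).
  by case/set2P: bq3 out => // bq3; rewrite !bq3 set21.
split; first by rewrite bq3 set22.
apply: contra out => /andP[bbq3 _]; apply/subsetP=> p.
rewrite inE -fconnect_orbit => /iter_findex <-; apply: iter_pair => //.
- by rewrite cards2; case: (_ != _).
- exact: set21.
- by rewrite -[delta q3 _]/(b q3) bq3 set22.
Qed.

(** Here [y] must be one of [q1, q3] for the [b] of [aab] to merge anything, and
the other one wanders. Since [b] is injective away from [x, y], it can be caught
in [q3, q4] in few ways. If [y = q1] then [q3] wanders; it is caught when fixed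
or when swapped with [q4], which the condition excludes, whereas [q3] and [q4]
do not both go to [q4]. If [y = q3] then [q1] wanders, and neither it nor [q4]
shares its image with another state, so it cannot be caught. *)
Lemma proper_compressible_x2 :
    x = q2 ->
  (compressible3 A /\ proper3 A <->
     [/\ y \in [set q1; q3], y = q1 -> b q3 = q4 /\ b q4 <> q3
       & y = q3 -> b q1 \in [set q3; q4]])
  /\ (proper3 A -> compressible3 A ->
    compresses3 A [:: La; Lb; Lb; La] \/ compresses3 A [:: La; Lb; Lb; Lb; La]).
Proof.
have := uniq_q; rewrite uniq4E.
move=> /and5P[q12 _ q14 q23 /andP[q24 q34]] xq2.
case: (boolP (y \in [set q1; q3])) => [/set2P y13|yN]; last first.
  have npr : ~ proper3 A.
    have cw : compresses3 A [:: La; La; Lb].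
      move: yN; rewrite !inE !negb_or => /andP[y1 y3].
      apply: compresses_aab; rewrite !inE negb_or xq2.
        by rewrite q12 eq_sym.
      by rewrite eq_sym q23 eq_sym.
    by move=> /(_ [:: La; La; Lb] erefl); rewrite cw.
  by split=> [|/npr//]; split=> [[_ /npr]|[]].
case: y13 => yE.
  have q3x : q3 != x by rewrite xq2 eq_sym.
  have [| |iffE imp] := @proper_compressibleE q1 q3 erefl _ q3x.
  - by rewrite yE set22.
  - by rewrite yE => q31; have := q13; rewrite q31 eqxx.
  split=> //; apply: iff_trans iffE _.
  split=> [[bq3 out]|[_ /(_ yE)[bq3 bq4] _]].
    split=> // [_|yq3]; last by have := q13; rewrite -yE yq3 eqxx.
    case/set2P: bq3 => bq3; first by rewrite !bq3 set21 in out.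
    by split=> // bq4; rewrite !bq3 !bq4 bq3 set21 set22 in out.
  split; first by rewrite bq3 set22.
  rewrite negb_and bq3; apply/orP; left; apply/negP=> /set2P[//|bq4'].
  have q3N : q3 \notin [set x; y].
    by rewrite !inE xq2 yE ![q3 == _]eq_sym negb_or q23 q13.
  by have := b_inj_out q3N (etrans bq3 (esym bq4')); apply/eqP.
have q1x : q1 != x by rewrite xq2.
have [||iffE imp] := @proper_compressibleE q3 q1 (setUC _ _) _ q1x.
- by rewrite yE set22.
- by rewrite yE => q31; have := q13; rewrite q31 eqxx.
split=> //; apply: iff_trans iffE _; split=> [[bq1 _]|[_ _ /(_ yE) bq1]].
  by split=> // yq1; have := q13; rewrite -yE yq1 eqxx.
split=> //; apply/negP=> /andP[bbq1 bbbq1].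
have q1N : q1 \notin [set x; y] by rewrite !inE xq2 yE negb_or q12.
have q4N : q4 \notin [set x; y].
  by rewrite !inE xq2 yE ![q4 == _]eq_sym negb_or q24.
(* Two of the three images in [q3, q4] coincide, which gives a state of [q3, q4]
   the same image as [q1], or gives [q3] the same image as [q4]. *)
case/set2P: bq1 bbq1 bbbq1 => bq1; rewrite !bq1 => /set2P[] bbq1.
- by case/eqP: q13; apply: b_inj_out q1N (etrans bq1 (esym bbq1)).
- rewrite bbq1 => /set2P[] bbbq1.
    by case/eqP: q14; apply: b_inj_out q1N (etrans bq1 (esym bbbq1)).
  by case/eqP: q34; apply/esym/(b_inj_out q4N (etrans bbbq1 (esym bbq1))).
- rewrite bbq1 => /set2P[] bbbq1.
    by case/eqP: q34; apply/esym/(b_inj_out q4N (etrans bbq1 (esym bbbq1))).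
  by case/eqP: q13; apply: b_inj_out q1N (etrans bq1 (esym bbbq1)).
- by case/eqP: q14; apply: b_inj_out q1N (etrans bq1 (esym bbq1)).
Qed.

End TypedLetters.

Theorem proposition14 (A : automaton) (q1 q2 q3 q4 x y : state A)
    (uniq_q : uniq [:: q1; q2; q3; q4])
    (neq_xy : x <> y)
    (type_a : type_two_pairs La q1 q2 q3 q4)
    (type_b : type_one_pair Lb x y) :
  (compressible3 A /\ proper3 A <->
    [/\ x \in [set q1; q2; q3; q4],
        x = q1 -> delta q3 Lb = q4 /\ ~~ (Orb Lb q3 \subset [set q3; q4]),
        x = q2 ->
          [/\ y \in [set q1; q3],
              y = q1 -> delta q3 Lb = q4 /\ delta q4 Lb <> q3
            & y = q3 -> delta q1 Lb \in [set q3; q4]],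
        x = q3 -> delta q1 Lb = q2 /\ ~~ (Orb Lb q1 \subset [set q1; q2])
      & x = q4 ->
          [/\ y \in [set q1; q3],
              y = q1 -> delta q3 Lb \in [set q1; q2]
            & y = q3 -> delta q1 Lb = q2 /\ delta q2 Lb <> q1]])
  /\
  (proper3 A -> compressible3 A ->
    compresses3 A [:: La; Lb; Lb; La] \/ compresses3 A [:: La; Lb; Lb; Lb; La]).
Proof.
have ta' := type_two_pairsC type_a.
have uq' : uniq [:: q3; q4; q1; q2] by rewrite (uniq_catC [:: q3; q4] [:: q1; q2]).
have := uniq_q; rewrite uniq4E.
move=> /and5P[/eqP q12 /eqP q13 /eqP q14 /eqP q23 /andP[/eqP q24 /eqP q34]].
case: (boolP (x \in [set q1; q2; q3; q4])) => [x1234|xN]; last first.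
  have npr : ~ proper3 A.
    by move/(proper_x uniq_q type_a type_b); apply/negP.
  by split=> [|/npr//]; split=> [[_ /npr]|[]].
case/setUP: x1234 => [/setUP[/set2P[]|/set1P]|/set1P] xE.
- have [|iffE imp] := proper_compressible_x1 uniq_q neq_xy type_a type_b _ xE.
    by rewrite xE set21.
  split=> //; apply: iff_trans iffE _; split=> [?|[_ /(_ xE)]//].
  by rewrite xE; split.
- have [|iffE imp] := proper_compressible_x2 uniq_q neq_xy type_a type_b _ xE.
    by rewrite xE set22.
  split=> //; apply: iff_trans iffE _; split=> [?|[_ _ /(_ xE)]//].
  by rewrite xE; split=> // /esym.
- have [|iffE imp] := proper_compressible_x1 uq' neq_xy ta' type_b _ xE.
    by rewrite xE set21.
  split=> //; apply: iff_trans iffE _; split=> [?|[_ _ _ /(_ xE)]//].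
  by rewrite xE; split=> // /esym.
- have [|iffE imp] := proper_compressible_x2 uq' neq_xy ta' type_b _ xE.
    by rewrite xE set22.
  split=> //; apply: iff_trans iffE _.
  split=> [[y13 y3 y1]|[_ _ _ _ /(_ xE)[y13 y1 y3]]].
    rewrite xE; split=> // [/esym//|/esym//|/esym//|_].
    by rewrite setUC.
  by rewrite setUC.
Qed.
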